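(* Let $\mathcal D=(G,\chi,a)$ be data with $\ell=|\chi(a)|\ge2$, let $\alpha:D(H_{\mathcal D})\to\mathbb K$ be an algebra map, and let $\beta_\alpha\in\Gamma$, $g_\alpha\in G$ be the elements determined by $\alpha(g\gamma)=\beta_\alpha(g)\gamma(g_\alpha)$ for all $g\in G$, $\gamma\in\Gamma$. Then $\mathbb K_\alpha\simeq H_{\mathcal D}\bullet_{\beta_\alpha}g_\alpha$ as Yetter-Drinfel'd $H_{\mathcal D}$-modules (equivalently, as $D(H_{\mathcal D})$-modules), where $\mathbb K_\alpha$ is the one-dimensional $D(H_{\mathcal D})$-module $\mathbb K$ with $h\cdot k=\alpha(h)k$.
   Context: $\mathbb K$ is an algebraically closed field of characteristic $0$; $|\cdot|$ of a group element denotes its order. Data $\mathcal D=(G,\chi,a)$ consists of a finite abelian group $G$, a character $\chi:G\to\mathbb K^\times$ and $a\in G$. With $\ell=|\chi(a)|$, $H_{\mathcal D}$ is the Hopf algebra generated as an algebra by $G$ and $x$ with the relations of $G$, $x^\ell=0$, and $xg=\chi(g)gx$ for all $g\in G$, with $\Delta(x)=x\otimes a+1\otimes x$ and $\Delta(g)=g\otimes g$ for $g\in G$. $\Gamma=\mathrm{Hom}(G,\mathbb K^\times)$; each $\beta\in\Gamma$ is extended to an algebra map $H_{\mathcal D}\to\mathbb K$ by $\beta(x)=0$, so $\Gamma=G(H_{\mathcal D}^* )$. For a finite-dimensional Hopf algebra $H$, the Drinfel'd double is $D(H)=(H^* )^{\mathrm{coop}}\otimes H$ as a coalgebra, with product $(g\otimes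 h)(f\otimes k)=\sum g\,(h_{(1)}\rightharpoonup f\leftharpoonup S^{-1}(h_{(3)}))\otimes h_{(2)}k$, where $\langle b\rightharpoonup f,c\rangle=\langle f,cb\rangle$ and $\langle f\leftharpoonup b,c\rangle=\langle f,bc\rangle$. With $\xi\in H_{\mathcal D}^*$ the functional $\xi(gx^j)=\delta_{j,1}$, $D(H_{\mathcal D})$ is generated by $G,x,\Gamma,\xi$ with relations $x^\ell=0$, $xg=\chi(g)gx$, $\xi^\ell=0$, $\xi\gamma=\gamma(a)\gamma\xi$, $g\gamma=\gamma g$, $\xi g=\chi^{-1}(g)g\xi$, $[x,\xi]=a-\chi$, $\gamma(a)x\gamma=\gamma x$ (with the relations of $G$ and $\Gamma$). Any algebra map $\alpha:D(H_{\mathcal D})\to\mathbb K$ vanishes on $x$ and $\xi$, hence is determined by its restriction to the group $G\times\Gamma$; since $\widehat{G\times\Gamma}\simeq\Gamma\times G$, the pair $(\beta_\alpha,g_\alpha)$ exists and is unique. $D(H)$-modules are the same as left-right Yetter-Drinfel'd $H$-modules: left $H$-modules with a right $H$-coaction $m\mapsto\sum m_{(0)}\otimes m_{(1)}$ satisfying $\sum h_{(1)}\cdot m_{(0)}\otimes h_{(2)}m_{(1)}=\sum (h_{(2)}\cdot m)_{(0)}\otimes(h_{(2)}\cdot m)_{(1)}h_{(1)}$, with $f\in H^*$ acting by $f\cdot m=\sum\langle f,m_{(1)}\rangle m_{(0)}$. For $\beta\in G(H^* )$ and $g\in G(H)$, $H\bullet_\beta g=\{h\bullet_\beta g:h\in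 H\}\subset H$, where $h\bullet_\beta b=\sum\beta(h_{(2)})h_{(3)}\,b\,S^{-1}(h_{(1)})$, is a Yetter-Drinfel'd module with action $\bullet_\beta$ and coaction $\Delta$. *)

(* Defs.v *)
From HB Require Import structures.
From mathcomp Require Import all_boot all_order all_algebra fingroup falgebra.

Set Implicit Arguments.
Unset Strict Implicit.
Unset Printing Implicit Defensive.

Import GRing.Theory.
Local Open Scope ring_scope.

(** * Tensor products of finite-dimensional vector spaces

    [V (x) W] is modelled by the matrices of coordinates with respect to the
    bases [vbasis {:V}] and [vbasis {:W}].  [tlift b] is the linear map
    [V (x) W -> U] attached to a bilinear map [b]; [tlift_tens] and
    [tensor_sum] are the universal property. *)

Section Tensor.
Variable K : fieldType.
Implicit Types U V W : vectType K.

Definition tensor V W : vectType K := 'M[K]_(\dim {:V}, \dim {:W}).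

Definition tens V W (v : V) (w : W) : tensor V W :=
  \matrix_(i, j) (coord (vbasis {:V}) i v * coord (vbasis {:W}) j w).

Definition tlift U V W (b : V -> W -> U) (t : tensor V W) : U :=
  \sum_i \sum_j (t : 'M[K]_(_, _)) i j *: b (vbasis {:V})`_i (vbasis {:W})`_j.

Lemma tlift_is_linear U V W (b : V -> W -> U) : linear (tlift b).
Proof.
move=> c s t; rewrite /tlift scaler_sumr -big_split; apply: eq_bigr => i _ /=.
rewrite scaler_sumr -big_split; apply: eq_bigr => j _ /=.
by rewrite !mxE scalerDl scalerA.
Qed.

HB.instance Definition _ U V W (b : V -> W -> U) :=
  GRing.isLinear.Build K (tensor V W) U *:%R (tlift b) (tlift_is_linear b).

Definition bilin U V W (b : V -> W -> U) :=
  (forall v, linear (b v)) /\ (forall w, linear (b^~ w)).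

Lemma lin_sum U V (f : V -> U) (n : nat) (c : 'I_n -> K) (e : 'I_n -> V) :
  linear f -> f (\sum_i c i *: e i) = \sum_i c i *: f (e i).
Proof.
move=> lf; pose fL := GRing.isLinear.Build K V U *:%R f lf.
pose F : {linear V -> U} := HB.pack f fL.
rewrite -[f]/(F : V -> U) linear_sum.
by apply: eq_bigr => i _; rewrite linearZ.
Qed.

Lemma tlift_tens U V W (b : V -> W -> U) v w :
  bilin b -> tlift b (tens v w) = b v w.
Proof.
case=> br bl.
rewrite {2}(coord_vbasis (memvf v)) (lin_sum (f := b^~ w)) //.
apply: eq_bigr => i _; rewrite {2}(coord_vbasis (memvf w)) lin_sum //.
by rewrite scaler_sumr; apply: eq_bigr => j _; rewrite scalerA mxE.
Qed.

Lemma tens_bilin V W : bilin (@tens V W).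
Proof.
by split=> [v | w] c u u'; apply/matrixP=> i j; rewrite !mxE linearP;
   rewrite ?mulrDl ?mulrDr ?mulrA // [_ * c]mulrC.
Qed.

Lemma tensor_sum V W (t : tensor V W) :
  t = \sum_i \sum_j (t : 'M[K]_(_, _)) i j *:
        tens (vbasis {:V})`_i (vbasis {:W})`_j.
Proof.
apply/matrixP=> p q; rewrite summxE (bigD1 p) //= summxE (bigD1 q) //= !mxE.
have fV := basis_free (vbasisP {:V}); have fW := basis_free (vbasisP {:W}).
rewrite !coord_free // !eqxx !mulr1 big1 => [|j nj]; last first.
  by rewrite !mxE !coord_free //  (negPf nj) !mulr0.
rewrite big1 ?addr0 // => i ni; rewrite summxE big1 // => j _.
by rewrite !mxE !coord_free // (negPf ni) mul0r mulr0.
Qed.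

Lemma tlift_eq U V W (b b' : V -> W -> U) t :
  (forall v w, b v w = b' v w) -> tlift b t = tlift b' t.
Proof.
by move=> e; apply: eq_bigr => i _; apply: eq_bigr => j _; rewrite e.
Qed.

Lemma tlift_comb U V W (b b' : V -> W -> U) c t :
  tlift (fun v w => c *: b v w + b' v w) t = c *: tlift b t + tlift b' t.
Proof.
rewrite /tlift scaler_sumr -big_split; apply: eq_bigr => i _ /=.
rewrite scaler_sumr -big_split; apply: eq_bigr => j _ /=.
by rewrite scalerDr !scalerA mulrC.
Qed.

Lemma linfunE_lin U V (f : V -> U) : linear f -> linfun f =1 f.
Proof.
move=> lf; pose fL := GRing.isLinear.Build K V U *:%R f lf.
pose F : {linear V -> U} := HB.pack f fL.
exact: (lfunE F).
Qed.

Definition tmap V V' W W' (f : 'Hom(V, V')) (g : 'Hom(W, W')) :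
    tensor V W -> tensor V' W' :=
  tlift (fun v w => tens (f v) (g w)).

Definition tassoc U V W :
    tensor (tensor U V) W -> tensor U (tensor V W) :=
  tlift (fun s w => tlift (fun u v => tens u (tens v w)) s).

Definition tensv V W (A : {vspace V}) (B : {vspace W}) :
    {vspace tensor V W} :=
  <<[seq tens v w | v <- vbasis A, w <- vbasis B]>>%VS.

End Tensor.

Section TensorAlgebra.
Variables (K : fieldType) (H : falgType K).

Definition tmul (s t : tensor H H) : tensor H H :=
  tlift (fun u v => tlift (fun u' v' => tens (u * u') (v * v')) t) s.

End TensorAlgebra.

Record hopfAlg (K : fieldType) := HopfAlg {
  hopf_sort :> falgType K;
  Delta : 'Hom(hopf_sort, tensor hopf_sort hopf_sort);
  eps : 'Hom(hopf_sort, K^o);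
  antip : 'End(hopf_sort);
  Delta_coassoc : forall h,
    tassoc (tmap Delta \1 (Delta h)) = tmap \1 Delta (Delta h);
  Delta_counitl : forall h, tlift (fun u v => eps u *: v) (Delta h) = h;
  Delta_counitr : forall h, tlift (fun u v => eps v *: u) (Delta h) = h;
  Delta1 : Delta 1 = tens 1 1;
  DeltaM : forall h k, Delta (h * k) = tmul (Delta h) (Delta k);
  eps1 : eps 1 = 1;
  epsM : forall h k, eps (h * k) = eps h * eps k;
  antip_l : forall h, tlift (fun u v => antip u * v) (Delta h) = (eps h)%:A;
  antip_r : forall h, tlift (fun u v => u * antip v) (Delta h) = (eps h)%:A
}.

Section HopfTheory.
Variables (K : fieldType) (H : hopfAlg K).
Implicit Types (U V W : vectType K).

(** Sweedler sums: [sw2 F h] is the sum of the [F h_(1) h_(2)], and [sw3 F h]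
    that of the [F h_(1) h_(2) h_(3)], for multilinear [F]. *)
Definition sw2 V (F : H -> H -> V) (h : H) : V := tlift F (Delta H h).

Definition sw3 V (F : H -> H -> H -> V) (h : H) : V :=
  sw2 (fun h' h3 => sw2 (fun h1 h2 => F h1 h2 h3) h') h.

(** The antipode of a finite-dimensional Hopf algebra is bijective, so the
    linear right inverse [_^-1] of the library is its inverse. *)
Definition antipV : 'End(H) := (antip H)^-1%VF.

Definition Hdual : vectType K := 'Hom(H, K^o).

Definition Hdual_mul (f g : Hdual) : Hdual :=
  linfun (sw2 (fun u v => f u * g v : K^o)).

Definition hitl (b : H) (f : Hdual) : Hdual := (f \o amulr b)%VF.
Definition hitr (f : Hdual) (b : H) : Hdual := (f \o amull b)%VF.

Lemma hitlE b f c : hitl b f c = f (c * b).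
Proof. by rewrite comp_lfunE lfunE. Qed.

Lemma hitrE b f c : hitr f b c = f (b * c).
Proof. by rewrite comp_lfunE lfunE. Qed.

Lemma sw2_is_linear V (F : H -> H -> V) : linear (sw2 F).
Proof. by move=> c h k; rewrite /sw2 !linearP. Qed.

HB.instance Definition _ V (F : H -> H -> V) :=
  GRing.isLinear.Build K H V *:%R (sw2 F) (sw2_is_linear F).

HB.instance Definition _ V (F : H -> H -> H -> V) :=
  GRing.isLinear.Build K H V *:%R (sw3 F) (sw2_is_linear _).

Lemma Hdual_mulE f g h : Hdual_mul f g h = sw2 (fun u v => f u * g v : K^o) h.
Proof. exact: lfunE. Qed.

(** The Drinfel'd double: the space [H^* (x) H] with the product
    [(g (x) h)(f (x) k) = sum g (h_(1) -> f <- S^-1(h_(3))) (x) h_(2) k], where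
    [hitl b f] is [b -> f] and [hitr f b] is [f <- b]. *)

Definition Ddouble : vectType K := tensor Hdual H.

Definition Ddouble1 : Ddouble := tens (eps H) 1.

Definition Ddouble_mul (s t : Ddouble) : Ddouble :=
  tlift (fun g h =>
    tlift (fun f k =>
      sw3 (fun h1 h2 h3 =>
        tens (Hdual_mul g (hitr (hitl h1 f) (antipV h3))) (h2 * k)) h) t) s.

Definition of_H (h : H) : Ddouble := tens (eps H) h.
Definition of_Hdual (f : Hdual) : Ddouble := tens f 1.

Definition Ddouble_algebra_map (alpha : 'Hom(Ddouble, K^o)) : Prop :=
  alpha Ddouble1 = 1 /\
  forall s t, alpha (Ddouble_mul s t) = alpha s * alpha t.

(** Modules over the double and Yetter-Drinfel'd modules

    The carrier is a subspace of an ambient space on which the structure maps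
    are defined; the axioms are only required on the carrier, which must be
    stable.  In this way a submodule carries literally the same structure
    maps. *)

Record DdoubleData := DDoubleData {
  dm_space : vectType K;
  dm_car : {vspace dm_space};
  dm_act : 'Hom(Ddouble, 'End(dm_space))
}.

Definition is_Ddouble_module (M : DdoubleData) : Prop :=
  [/\ forall s m, m \in dm_car M -> dm_act M s m \in dm_car M,
      forall m, m \in dm_car M -> dm_act M Ddouble1 m = m
    & forall s t m, m \in dm_car M ->
        dm_act M (Ddouble_mul s t) m = dm_act M s (dm_act M t m)].

Record ydData := YDData {
  yd_space : vectType K;
  yd_car : {vspace yd_space};
  yd_act : 'Hom(H, 'End(yd_space));
  yd_coact : 'Hom(yd_space, tensor yd_space H)
}.

Record is_YD_module (M : ydData) : Prop := {
  yd_act_stable : forall h m, m \in yd_car M -> yd_act M h m \in yd_car M;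
  yd_act1 : forall m, m \in yd_car M -> yd_act M 1 m = m;
  yd_actM : forall h k m, m \in yd_car M ->
    yd_act M (h * k) m = yd_act M h (yd_act M k m);
  yd_coact_stable : forall m, m \in yd_car M ->
    yd_coact M m \in tensv (yd_car M) {:H};
  yd_coassoc : forall m, m \in yd_car M ->
    tassoc (tmap (yd_coact M) \1 (yd_coact M m)) =
    tmap \1 (Delta H) (yd_coact M m);
  yd_counit : forall m, m \in yd_car M ->
    tlift (fun n h => eps H h *: n) (yd_coact M m) = m;
  yd_compat : forall h m, m \in yd_car M ->
    sw2 (fun h1 h2 => tmap (yd_act M h1) (amull h2) (yd_coact M m)) h =
    sw2 (fun h1 h2 => tmap \1 (amulr h1) (yd_coact M (yd_act M h2 m))) h
}.

Definition bij_between V W (A : {vspace V}) (B : {vspace W})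
    (f : 'Hom(V, W)) : Prop :=
  {in A &, injective f} /\ (f @: A)%VS = B.

Definition Ddouble_iso (M N : DdoubleData) : Prop :=
  [/\ is_Ddouble_module M, is_Ddouble_module N
    & exists2 f : 'Hom(dm_space M, dm_space N),
        bij_between (dm_car M) (dm_car N) f
      & forall s m, m \in dm_car M -> f (dm_act M s m) = dm_act N s (f m)].

Definition YD_iso (M N : ydData) : Prop :=
  [/\ is_YD_module M, is_YD_module N
    & exists2 f : 'Hom(yd_space M, yd_space N),
        bij_between (yd_car M) (yd_car N) f
      & (forall h m, m \in yd_car M -> f (yd_act M h m) = yd_act N h (f m)) /\
        (forall m, m \in yd_car M ->
           yd_coact N (f m) = tmap f \1 (yd_coact M m))].

(** [f . m = <f, m_(1)> m_(0)], hence [(f (x) h) . m = f . (h . m)] *)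

Definition contract V (f : Hdual) : 'Hom(tensor V H, V) :=
  linfun (tlift (fun (v : V) (h : H) => (f h : K) *: v)).

Definition Ddouble_of_YD (M : ydData) : DdoubleData :=
  @DDoubleData (yd_space M) (yd_car M)
    (linfun (tlift (fun (f : Hdual) (h : H) =>
       (contract (yd_space M) f \o yd_coact M \o yd_act M h)%VF))).

(** Conversely, the coaction is recovered from the action of [H^*] as
    [m |-> sum_i (e^i . m) (x) e_i] for a basis [e_i] of [H] with dual basis
    [e^i]; see [YD_of_Ddouble_dual]. *)

Definition Hdual_basis (i : 'I_(\dim {:H})) : Hdual :=
  linfun (coord (vbasis {:H}) i : H -> K^o).

Definition coact_of_Ddouble (M : DdoubleData) (m : dm_space M) :
    tensor (dm_space M) H :=
  \sum_i tens (dm_act M (of_Hdual (Hdual_basis i)) m) (vbasis {:H})`_i.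

Definition YD_of_Ddouble (M : DdoubleData) : ydData :=
  @YDData (dm_space M) (dm_car M)
    (linfun (fun h => dm_act M (of_H h))) (linfun (@coact_of_Ddouble M)).

Lemma contract_tens V f (v : V) h :
  contract V f (tens v h) = (f h : K) *: v.
Proof.
rewrite lfunE /= tlift_tens //; split=> [x | x] c y z.
  by rewrite linearP /= scalerDl scalerA.
by rewrite scalerDr !scalerA mulrC.
Qed.

Lemma Ddouble_of_YD_act (M : ydData) f h m :
  dm_act (Ddouble_of_YD M) (tens f h) m =
  contract _ f (yd_coact M (yd_act M h m)).
Proof.
rewrite lfunE /= tlift_tens ?comp_lfunE ?[in LHS]comp_lfunE //.
split=> [g | k] c x y; apply/lfunP=> n.
  by rewrite add_lfunE scale_lfunE !comp_lfunE linearP add_lfunE scale_lfunE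
             !linearP.
rewrite add_lfunE scale_lfunE !comp_lfunE !lfunE /= -tlift_comb.
by apply: tlift_eq => v w; rewrite add_lfunE scale_lfunE scalerDl scalerA.
Qed.

Lemma YD_of_Ddouble_actE (M : DdoubleData) h m :
  yd_act (YD_of_Ddouble M) h m = dm_act M (of_H h) m.
Proof.
rewrite linfunE_lin // => c x y.
by rewrite /of_H (tens_bilin _ _).1 linearP.
Qed.

Lemma YD_of_Ddouble_coactE (M : DdoubleData) m :
  yd_coact (YD_of_Ddouble M) m = coact_of_Ddouble m.
Proof.
rewrite linfunE_lin // => c x y; rewrite /coact_of_Ddouble scaler_sumr.
rewrite -big_split; apply: eq_bigr => i _ /=.
by rewrite linearP (tens_bilin _ _).2.
Qed.

Lemma YD_of_Ddouble_dual (M : DdoubleData) (f : Hdual) m :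
  contract _ f (yd_coact (YD_of_Ddouble M) m) = dm_act M (of_Hdual f) m.
Proof.
rewrite YD_of_Ddouble_coactE linear_sum /=.
have {2}->: f = \sum_(i < \dim {:H}) (f (vbasis {:H})`_i : K) *: Hdual_basis i.
  apply/lfunP=> h; rewrite {1}(coord_vbasis (memvf h)) linear_sum sum_lfunE.
  apply: eq_bigr => i _; rewrite linearZ scale_lfunE lfunE /=.
  by rewrite [LHS]mulrC.
rewrite (lin_sum (f := of_Hdual)); last exact: (tens_bilin _ _).2.
rewrite linear_sum sum_lfunE; apply: eq_bigr => i _.
by rewrite contract_tens linearZ scale_lfunE.
Qed.

Definition char_module (alpha : 'Hom(Ddouble, K^o)) : DdoubleData :=
  @DDoubleData K^o {:K^o} (linfun (fun s => (alpha s : K) *: \1%VF)).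

Lemma char_module_act alpha s (k : K) :
  dm_act (char_module alpha) s k = alpha s * k.
Proof.
rewrite linfunE_lin ?scale_lfunE ?id_lfunE // => c x y.
by rewrite linearP /= scalerDl scalerA.
Qed.

Definition bullet (beta : Hdual) (h b : H) : H :=
  sw3 (fun h1 h2 h3 => (beta h2 : K) *: (h3 * b * antipV h1)) h.

Definition bullet_lfun (beta : Hdual) : 'Hom(H, 'End(H)) :=
  linfun (fun h => linfun (bullet beta h)).

Definition bullet_space (beta : Hdual) (b : H) : {vspace H} :=
  limg (linfun (fun h => bullet beta h b)).

Definition bullet_module (beta : Hdual) (b : H) : ydData :=
  @YDData H (bullet_space beta b) (bullet_lfun beta) (Delta H).

Lemma bullet_linearl beta b : linear (fun h => bullet beta h b).
Proof. by move=> c x y; rewrite /bullet linearP. Qed.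

Lemma bullet_linearr beta h : linear (bullet beta h).
Proof.
move=> c x y; rewrite /bullet /sw3 /sw2 -tlift_comb.
apply: tlift_eq => h' h3; rewrite -tlift_comb; apply: tlift_eq => h1 h2.
by rewrite mulrDr mulrDl scalerDr -scalerAr -scalerAl !scalerA mulrC.
Qed.

Lemma bullet_lfunE beta h b : bullet_lfun beta h b = bullet beta h b.
Proof.
rewrite linfunE_lin => [|c x y]; first exact/linfunE_lin/bullet_linearr.
apply/lfunP=> z; rewrite add_lfunE scale_lfunE !linfunE_lin;
  [exact: bullet_linearl | exact: bullet_linearr ..].
Qed.

Lemma bullet_spaceP beta b u :
  reflect (exists h, u = bullet beta h b) (u \in bullet_space beta b).
Proof.
have E := linfunE_lin (bullet_linearl beta b).
apply: (iffP memv_imgP) => [[h _ ->] | [h ->]]; exists h; rewrite ?memvf //;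
  exact: E.
Qed.

End HopfTheory.

Record character (gT : finGroupType) (K : fieldType) := Character {
  char_fun :> gT -> K;
  char_fun1 : char_fun 1%g = 1;
  char_funM : forall g h, char_fun (g * h)%g = char_fun g * char_fun h
}.

(** [ell] is the order of [chi a] in the multiplicative group of [K]. *)
Record datum (gT : finGroupType) (K : fieldType) := Datum {
  chi : character gT K;
  pt : gT;
  ell : nat;
  ell_order : ell.-primitive_root (chi pt)
}.

Section HD.
Variables (gT : finGroupType) (K : fieldType) (D : datum gT K).

Definition HD_rel (A : algType K) (iG : gT -> A) (x : A) : Prop :=
  [/\ iG 1%g = 1, forall g h, iG (g * h)%g = iG g * iG h,
      x ^+ ell D = 0 & forall g, x * iG g = chi D g *: (iG g * x)].

(** A Hopf algebra which, as an algebra, is presented by the generators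
    [grp g], [xgen] and the relations [HD_rel].  The presentation is expressed
    by its universal property: the fields [HD_relP] to [HD_lift_uniq]. *)
Record HD_alg := HDAlg {
  HD_hopf :> hopfAlg K;
  grp : gT -> HD_hopf;
  xgen : HD_hopf;
  HD_relP : HD_rel grp xgen;
  HD_lift : forall (A : algType K) (f : gT -> A) (y : A),
    HD_rel f y -> {lrmorphism HD_hopf -> A};
  HD_lift_grp : forall (A : algType K) (f : gT -> A) (y : A)
    (r : HD_rel f y) g, HD_lift r (grp g) = f g;
  HD_lift_xgen : forall (A : algType K) (f : gT -> A) (y : A)
    (r : HD_rel f y), HD_lift r xgen = y;
  HD_lift_uniq : forall (A : algType K) (p q : {lrmorphism HD_hopf -> A}),
    (forall g, p (grp g) = q (grp g)) -> p xgen = q xgen -> p =1 q;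
  Delta_grp : forall g, Delta HD_hopf (grp g) = tens (grp g) (grp g);
  Delta_xgen : Delta HD_hopf xgen = tens xgen (grp (pt D)) + tens 1 xgen
}.

(** The elements of the character group, extended by [0] at [x] *)

Lemma char_HD_rel (gamma : character gT K) :
  @HD_rel K^o gamma 0.
Proof.
split; [exact: (char_fun1 gamma) | exact: (char_funM gamma) | | ].
  by rewrite expr0n gtn_eqF // (prim_order_gt0 (ell_order D)).
by move=> g; rewrite mul0r mulr0 scaler0.
Qed.

Definition char_ext (H : HD_alg) (gamma : character gT K) : Hdual H :=
  linfun (HD_lift H (char_HD_rel gamma)).

Lemma char_ext_grp (H : HD_alg) gamma g : char_ext H gamma (grp H g) = gamma g.
Proof. by rewrite lfunE /= HD_lift_grp. Qed.

Lemma char_ext_xgen (H : HD_alg) gamma : char_ext H gamma (xgen H) = 0.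
Proof. by rewrite lfunE /= HD_lift_xgen. Qed.

Lemma char_extM (H : HD_alg) gamma h k :
  char_ext H gamma (h * k) = char_ext H gamma h * char_ext H gamma k.
Proof. by rewrite !lfunE /= rmorphM. Qed.

End HD.

(* Main.v *)
Require Import Defs.
From HB Require Import structures.
From mathcomp Require Import all_boot all_algebra fingroup falgebra.
From mathcomp Require Import cyclic mxrepresentation cyclotomic separable.

Set Implicit Arguments.
Unset Strict Implicit.
Unset Printing Implicit Defensive.

Import GRing.Theory.
Local Open Scope ring_scope.

(** An algebra map [alpha] on the double restricts to an algebra map
    [beta := alpha_H alpha] on [H] and, [H] being finite-dimensional, to the
    evaluation at an element [u := alpha_pt alpha] on [H^*].

    The straightening rule of the double says that these two restrictions
    satisfy [sum beta(h_(1)) h_(2) u = sum beta(h_(2)) u h_(1)]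
    ([alpha_twisted_central]).  This holds for every Hopf algebra whose antipode
    is bijective, and has two consequences.  It is the Yetter-Drinfel'd
    compatibility of the line on which [H] acts by [beta] and coacts by [u];
    and it gives [h . u = beta(h) u] for the action defining the bullet module
    ([bullet_central]), so that this module is the line spanned by [u].  When
    [u] is group-like, both modules of the theorem are thus lines with the same
    action and coaction ([one_dimensional_bullet]).

    It remains to identify [beta] and [u] for the algebra [H] generated by [G]
    and [x].  As [x] is nilpotent, [beta] vanishes on it and is the extension of
    its restriction to [G].  The element [u] commutes with [a], and conjugation
    by [a] scales [g x^j] by a power of [chi(a)^j]; hence [u] lies in the span
    of [G] ([centraliser_group_span]).  Finally [gamma(u) = gamma(b)] for every
    character [gamma] of [G], and characters separate the elements of the group
    algebra of an abelian group ([characters_separate]), so [u] is [b], which is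
    group-like.

    The antipode of [H] is bijective because it reverses products ([antipM]) and
    its image contains the generators ([HD_antip_onto]). *)

(** * Characters of a finite abelian group *)

(** [rG g] is a root of ['X^#|G| - 1], which splits over a closed field and has
    simple roots because [#|G|] is invertible in characteristic 0. *)
Lemma repr_diagonalizable (K : closedFieldType) (gT : finGroupType)
    (G : {group gT}) n (rG : mx_representation K G n) g :
  [pchar K] =i pred0 -> g \in G -> diagonalizable (rG g).
Proof.
move=> /pcharf0P char0 Gg; case: n rG => [|n] rG.
  exists 1%:M; rewrite ?unitmx1 // flatmx0 /similar_to.
  by apply/is_diag_mxP=> -[].
have gn : (rG g) ^+ #|G| = 1.
  suff E k : rG g ^+ k = rG (g ^+ k)%g by rewrite E expg_cardG // repr_mx1.
  elim: k => [|k IHk]; first by rewrite repr_mx1.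
  by rewrite exprS IHk expgS repr_mxM // groupX.
have nG : #|G|%:R != 0 :> K by rewrite char0 -lt0n cardG_gt0.
have [r rE] := closed_field_poly_normal ('X^#|G| - 1 : {poly K}).
rewrite (monicP (monic_Xn_sub_1 _ (cardG_gt0 G))) scale1r in rE.
apply/diagonalizableP; exists r.
  by rewrite -separable_prod_XsubC -rE separable_Xn_sub_1.
rewrite -rE mxminpoly_min // rmorphB rmorph1 rmorphXn /= horner_mx_X.
by rewrite gn subrr.
Qed.

(** The operators of the regular representation commute and are diagonalizable,
    hence are diagonal in a common basis, in which each diagonal entry is a
    character.  A combination of group elements killed by all characters thus
    acts by [0] on the group algebra, on which the group algebra acts
    faithfully. *)
Lemma characters_separate (K : closedFieldType) (gT : finGroupType)
    (char0 : [pchar K] =i pred0) (abG : abelian [set: gT]) (c : gT -> K) :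
  (forall gamma : character gT K, \sum_g c g * gamma g = 0) ->
  forall g, c g = 0.
Proof.
move=> c0; pose rG := regular_repr K [set: gT].
have [|P Pu Pd] := (@codiagonalizableP _ _ [seq rG g | g <- enum gT]).1.
  split; last first.
    move=> _ /mapP[g _ ->].
    exact: (repr_diagonalizable rG char0 (in_setT g)).
  move=> _ _ /mapP[g _ ->] /mapP[h _ ->].
  by rewrite /comm_mx -!repr_mxM ?inE // (centsP abG _ _ h) ?inE.
pose R g := P *m rG g *m invmx P.
have Rd g : is_diag_mx (R g).
  have /allP/(_ (rG g)) := Pd; rewrite map_f ?mem_enum // => /(_ isT).
  by rewrite /= /similar_to conjumx.
have RM g h : R (g * h)%g = R g *m R h.
  by rewrite /R repr_mxM ?inE // !mulmxA mulmxKV.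
have R1 : R 1%g = 1%:M by rewrite /R repr_mx1 mulmx1 mulmxV.
have diagM i g h : R (g * h)%g i i = R g i i * R h i i.
  rewrite RM mxE (bigD1 i) //= big1 ?addr0 // => j ji.
  by have /is_diag_mxP/(_ j i ji) -> := Rd h; rewrite mulr0.
have diag1 i : R 1%g i i = 1 by rewrite R1 mxE eqxx.
have sumR : \sum_g c g *: R g = 0.
  apply/matrixP=> i j; rewrite summxE mxE; have [<-|ij] := eqVneq i j.
    rewrite -[RHS](c0 (Character (diag1 i) (diagM i))).
    by apply: eq_bigr => g _; rewrite mxE.
  rewrite big1 // => g _; rewrite mxE.
  by have /is_diag_mxP/(_ _ _ ij) -> := Rd g; rewrite mulr0.
have sumG : \sum_g c g *: rG g = 0.
  have: \sum_g c g *: R g = P *m (\sum_g c g *: rG g) *m invmx P.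
    rewrite mulmx_sumr mulmx_suml; apply: eq_bigr => g _.
    by rewrite -scalemxAr -scalemxAl.
  rewrite sumR => E; rewrite -[LHS](mulKmx Pu).
  by rewrite -[X in invmx P *m X](mulmxKV Pu) -E mul0mx mulmx0.
move=> g; have := congr1 (@gring_proj K gT [set: gT]%G g) sumG.
rewrite linear0 linear_sum (bigD1 g) //= big1 ?addr0 => [|h hg].
  by rewrite linearZ /= gring_projE ?inE // eqxx => /matrixP/(_ 0 0);
    rewrite !mxE mulr1.
by rewrite linearZ /= gring_projE ?inE // eq_sym (negPf hg) scaler0.
Qed.

(** * Multilinear maps and Sweedler sums *)

Section Multilinear.
Variable K : fieldType.
Implicit Types U V W X Y : vectType K.

Lemma linear_id V : linear (fun v : V => v).
Proof. by []. Qed.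

Lemma linear_hom U V X (f : 'Hom(V, X)) (g : U -> V) :
  linear g -> linear (fun u => f (g u)).
Proof. by move=> lg c x y; rewrite lg linearP. Qed.

Lemma linear_scalel U V (g : U -> K^o) (v : V) :
  linear g -> linear (fun u => (g u : K) *: v).
Proof. by move=> lg c x y; rewrite lg scalerDl scalerA. Qed.

Lemma linear_scaler U V (k : K) (g : U -> V) :
  linear g -> linear (fun u => k *: g u).
Proof. by move=> lg c x y; rewrite lg scalerDr !scalerA mulrC. Qed.

Lemma linear_mull U (A : falgType K) (a : A) (g : U -> A) :
  linear g -> linear (fun u => a * g u).
Proof. by move=> lg c x y; rewrite lg mulrDr scalerAr. Qed.

Lemma linear_mulr U (A : falgType K) (a : A) (g : U -> A) :
  linear g -> linear (fun u => g u * a).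
Proof. by move=> lg c x y; rewrite lg mulrDl scalerAl. Qed.

Lemma linear_sub U V (f g : U -> V) :
  linear f -> linear g -> linear (fun u => f u - g u).
Proof.
by move=> lf lg c x y; rewrite lf lg scalerBr opprD addrACA.
Qed.

Lemma linear_at0 U V (f : U -> V) : linear f -> f 0 = 0.
Proof.
by move=> lf; have := lf (-1) 0 0; rewrite scaler0 addr0 scaleN1r addNr.
Qed.

Lemma linear_at_scale U V (f : U -> V) c u : linear f -> f (c *: u) = c *: f u.
Proof. by move=> lf; have := lf c u 0; rewrite (linear_at0 lf) !addr0. Qed.

Lemma linear_tensl U V W (w : W) (g : U -> V) :
  linear g -> linear (fun u => tens (g u) w).
Proof. by move=> lg c x y; rewrite lg; exact: (tens_bilin V W).2. Qed.

Lemma linear_tensr U V W (v : V) (g : U -> W) :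
  linear g -> linear (fun u => tens v (g u)).
Proof. by move=> lg c x y; rewrite lg; exact: (tens_bilin V W).1. Qed.

Lemma linear_tlift U V W X (b : V -> W -> X) (g : U -> tensor V W) :
  linear g -> linear (fun u => tlift b (g u)).
Proof. by move=> lg c x y; rewrite lg linearP. Qed.

Lemma linear_tlift_param U V W X (b : U -> V -> W -> X) t :
  (forall v w, linear (fun u => b u v w)) -> linear (fun u => tlift (b u) t).
Proof.
move=> lb c x y; rewrite -tlift_comb; apply: tlift_eq => v w; exact: lb.
Qed.

Definition trilin U V W X (F : U -> V -> W -> X) :=
  [/\ forall v w, linear (fun u => F u v w),
      forall u w, linear (fun v => F u v w) & forall u v, linear (F u v)].

Lemma tlift_lin V W X Y (f : X -> Y) (b : V -> W -> X) t :
  linear f -> f (tlift b t) = tlift (fun v w => f (b v w)) t.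
Proof.
move=> lf; rewrite /tlift.
have f0 := linear_at0 lf.
have fD x y : f (x + y) = f x + f y by have := lf 1 x y; rewrite !scale1r.
rewrite (big_morph f fD f0); apply: eq_bigr => i _.
rewrite (big_morph f fD f0); apply: eq_bigr => j _.
exact: linear_at_scale.
Qed.

Lemma tlift_exchange V W V' W' X (F : V -> W -> V' -> W' -> X) s t :
  tlift (fun v w => tlift (F v w) t) s =
  tlift (fun v' w' => tlift (fun v w => F v w v' w') s) t.
Proof.
have -> : tlift (fun v w => tlift (F v w) t) s =
    \sum_i \sum_j \sum_k \sum_l
      ((s : 'M_(_, _)) i j * (t : 'M_(_, _)) k l) *:
      F (vbasis {:V})`_i (vbasis {:W})`_j (vbasis {:V'})`_k (vbasis {:W'})`_l.
  rewrite /tlift; do 2![apply: eq_bigr => ? _]; rewrite scaler_sumr.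
  by apply: eq_bigr => ? _; rewrite scaler_sumr; apply: eq_bigr => ? _;
    rewrite scalerA.
under eq_bigr => i _ do rewrite exchange_big.
rewrite exchange_big; apply: eq_bigr => k _.
under eq_bigr => i _ do rewrite exchange_big.
rewrite exchange_big; apply: eq_bigr => l _; rewrite scaler_sumr.
apply: eq_bigr => i _; rewrite scaler_sumr; apply: eq_bigr => j _.
by rewrite scalerA mulrC.
Qed.

End Multilinear.

Section Sweedler.
Variables (K : fieldType) (H : hopfAlg K).
Implicit Types V : vectType K.

Lemma linear_sw2 (U V : vectType K) (F : H -> H -> V) (g : U -> H) :
  linear g -> linear (fun u => sw2 F (g u)).
Proof. by move=> lg c x y; rewrite lg linearP. Qed.

Lemma linear_sw2_param (U V : vectType K) (F : U -> H -> H -> V) h :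
  (forall v w, linear (fun u => F u v w)) -> linear (fun u => sw2 (F u) h).
Proof. exact: linear_tlift_param. Qed.

Lemma sw2_eq V (F F' : H -> H -> V) h :
  (forall u v, F u v = F' u v) -> sw2 F h = sw2 F' h.
Proof. exact: tlift_eq. Qed.

Lemma sw2B V (F F' : H -> H -> V) h :
  sw2 (fun u v => F u v - F' u v) h = sw2 F h - sw2 F' h.
Proof.
rewrite [RHS]addrC -scaleN1r /sw2 -tlift_comb.
by apply: tlift_eq => u v; rewrite scaleN1r addrC.
Qed.

Lemma sw2_lin V V' (f : V -> V') (F : H -> H -> V) h :
  linear f -> f (sw2 F h) = sw2 (fun u v => f (F u v)) h.
Proof. exact: tlift_lin. Qed.

Lemma sw2_tens V (F : H -> H -> V) h u v :
  bilin F -> Delta H h = tens u v -> sw2 F h = F u v.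
Proof. by move=> bF e; rewrite /sw2 e tlift_tens. Qed.

(** Both sides are the image of the iterated coproduct under the linear map
    [G] that [F] induces on [H (x) (H (x) H)]. *)
Lemma sw2_coassoc V (F : H -> H -> H -> V) h : trilin F ->
  sw2 (fun p h3 => sw2 (fun h1 h2 => F h1 h2 h3) p) h =
  sw2 (fun h1 q => sw2 (F h1) q) h.
Proof.
case=> F1 F2 F3.
pose G (t : tensor H (tensor H H)) := tlift (fun u s => tlift (F u) s) t.
have bG : bilin (fun u s => tlift (F u) s).
  by split=> [u | s]; [apply: linear_tlift | apply: linear_tlift_param].
have lG : linear G by apply: linear_tlift.
have := congr1 G (Delta_coassoc h); rewrite /sw2.
rewrite /tmap !tlift_lin //; try exact: linear_tlift.
move=> e; transitivity (tlift (fun v w : H =>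
    G (tassoc (tens (Delta H v) (\1%VF w)))) (Delta H h)).
  apply: tlift_eq => p h3; rewrite id_lfunE /tassoc tlift_tens; last first.
    split=> [s|w]; last exact: linear_tlift.
    by apply: linear_tlift_param => v w; do 2!apply: linear_tensr.
  rewrite tlift_lin //; apply: tlift_eq => h1 h2.
  by rewrite /G tlift_tens // tlift_tens //; split.
rewrite e; apply: tlift_eq => h1 q.
by rewrite /G tlift_tens // id_lfunE.
Qed.

Lemma sw2_counitl V (f : H -> V) h :
  linear f -> sw2 (fun u v => (eps H u : K) *: f v) h = f h.
Proof.
move=> lf; rewrite -[in RHS](Delta_counitl h) -/(sw2 _ h) sw2_lin //.
by apply: sw2_eq => u v; rewrite linear_at_scale.
Qed.

Lemma sw2_counitr V (f : H -> V) h :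
  linear f -> sw2 (fun u v => (eps H v : K) *: f u) h = f h.
Proof.
move=> lf; rewrite -[in RHS](Delta_counitr h) -/(sw2 _ h) sw2_lin //.
by apply: sw2_eq => u v; rewrite linear_at_scale.
Qed.

Lemma sw2M V (F : H -> H -> V) h k : bilin F ->
  sw2 F (h * k) =
  sw2 (fun h1 h2 => sw2 (fun k1 k2 => F (h1 * k1) (h2 * k2)) k) h.
Proof.
move=> bF; rewrite /sw2 DeltaM /tmul tlift_lin; last by apply: linear_tlift.
apply: tlift_eq => h1 h2; rewrite tlift_lin; last by apply: linear_tlift.
by apply: tlift_eq => k1 k2; rewrite tlift_tens.
Qed.

Lemma sw2_exchange V (F : H -> H -> H -> H -> V) h k :
  sw2 (fun h1 h2 => sw2 (F h1 h2) k) h =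
  sw2 (fun k1 k2 => sw2 (fun h1 h2 => F h1 h2 k1 k2) h) k.
Proof. exact: tlift_exchange. Qed.

End Sweedler.

(** A Sweedler sum commutes with linear maps only, and it can be evaluated on a
    pure tensor only if its summand is multilinear; [lin] discharges these side
    conditions by descending into the expression along the bound variable. *)
Ltac lin :=
  repeat first
    [ exact: linear_id
    | match goal with |- trilin _ => split=> ? ? end
    | match goal with |- bilin _ => split=> ? end
    | apply: linear_mull | apply: linear_mulr
    | apply: linear_scaler | apply: linear_scalel
    | apply: linear_sub
    | apply: linear_tensl | apply: linear_tensr
    | apply: linear_sw2 | (apply: linear_sw2_param => ? ?)
    | apply: linear_hom ].

(** * The antipode and its inverse *)

Section Antipode.
Variables (K : fieldType) (H : hopfAlg K).
Local Notation S := (antip H).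
Local Notation e := (eps H).

Lemma antip_lE h : sw2 (fun u v => S u * v) h = (e h)%:A.
Proof. exact: antip_l. Qed.

Lemma antip_rE h : sw2 (fun u v => u * S v) h = (e h)%:A.
Proof. exact: antip_r. Qed.

(** The identity of [H] is invertible for convolution, with inverse [S]: so
    [T] is recovered from its convolution product with the identity. *)
Lemma convolution_id_injective (T : H -> H) : linear T ->
  (forall h, sw2 (fun u v => T u * v) h = 0) -> forall h, T h = 0.
Proof.
move=> lT T0 h; rewrite -(sw2_counitr h lT).
have -> : sw2 (fun u v => (e v : K) *: T u) h =
    sw2 (fun u q => sw2 (fun v w => T u * (v * S w)) q) h.
  apply: sw2_eq => u q.
  rewrite -(sw2_lin (f := fun z => T u * z)); last by lin.
  by rewrite antip_rE mulr_algr.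
rewrite -sw2_coassoc; last first.
  by split=> ? ?; [apply: linear_mulr | lin | lin].
(* The vanishing integrand is written as 0 times a bilinear one, so that the
   scalar can be taken out of the sum. *)
transitivity (sw2 (fun p w => 0 *: (p * w)) h).
  apply: sw2_eq => p w; rewrite scale0r -[RHS](mul0r (S w)) -(T0 p).
  rewrite (sw2_lin (f := fun z => z * S w)); last by lin.
  by apply: sw2_eq => u v; rewrite mulrA.
by rewrite -(sw2_lin (f := fun z : H => 0 *: z)) ?scale0r //; lin.
Qed.

(** Both sides are compared after convolution with the identity, first in the
    variable [k] (giving [Sh]) and then in the variable [h]. *)
Lemma antipM h k : S (h * k) = S k * S h.
Proof.
have Sh h' k' : sw2 (fun h1 h2 => S (h1 * k') * h2) h' = (e h' : K) *: S k'.
  apply/eqP; rewrite -subr_eq0; apply/eqP.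
  apply: (convolution_id_injective (T := fun k' =>
    sw2 (fun h1 h2 => S (h1 * k') * h2) h' - (e h' : K) *: S k')) => [|k''].
    by lin.
  transitivity
      (sw2 (fun k1 k2 => sw2 (fun h1 h2 => S (h1 * k1) * (h2 * k2)) h') k'' -
       sw2 (fun k1 k2 => (e h' : K) *: (S k1 * k2)) k'').
    rewrite -sw2B; apply: sw2_eq => k1 k2; rewrite mulrBl -scalerAl.
    congr (_ - _).
    rewrite (sw2_lin (f := fun z => z * k2)); last by lin.
    by apply: sw2_eq => h1 h2; rewrite mulrA.
  rewrite -sw2_exchange -(sw2M (F := fun a b => S a * b)); last by lin.
  rewrite -(sw2_lin (f := fun z => (e h' : K) *: z)); last by lin.
  by rewrite !antip_lE epsM scalerA subrr.
apply/eqP; rewrite -subr_eq0; apply/eqP.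
apply: (convolution_id_injective (T := fun h => S (h * k) - S k * S h)).
  by lin.
move=> h'; transitivity (sw2 (fun u v => S (u * k) * v) h' -
                         sw2 (fun u v => S k * (S u * v)) h').
  by rewrite -sw2B; apply: sw2_eq => u v; rewrite mulrBl mulrA.
rewrite Sh -(sw2_lin (f := fun z => S k * z)); last by lin.
by rewrite antip_lE mulr_algr subrr.
Qed.

Lemma antip1 : S 1 = 1.
Proof.
have := antip_lE 1; rewrite (@sw2_tens _ _ _ _ 1 1 1); [|by lin|exact: Delta1].
by rewrite mulr1 eps1 scale1r.
Qed.

Lemma eps_antip h : e (S h) = e h.
Proof.
have l : linear (fun u => e (S u)) by lin.
rewrite -(sw2_counitr h l); transitivity (sw2 (fun u v => e (S u * v)) h).
  by apply: sw2_eq => u v; rewrite epsM [LHS]mulrC.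
rewrite -(sw2_lin (f := e)); last by lin.
by rewrite antip_lE linearZ /= eps1 [LHS]mulr1.
Qed.

Section Inverse.
Hypothesis antip_onto : forall h, exists k, S k = h.
Local Notation S' := (antipV H).

Lemma antipVK h : S (S' h) = h.
Proof.
by have [k <-] := antip_onto h; rewrite limg_lfunVK // memv_img ?memvf.
Qed.

Lemma antip_inj : injective S.
Proof.
suff: lker S == 0%VS by move/lker0P.
suff: limg S = fullv.
  move=> im; have := limg_ker_dim S fullv; rewrite capfv im => /eqP.
  by rewrite -[X in _ == X]add0n eqn_add2r dimv_eq0.
by apply/vspaceP=> h; rewrite memvf; have [k <-] := antip_onto h;
  rewrite memv_img ?memvf.
Qed.

Lemma eps_antipV h : e (S' h) = e h.
Proof. by rewrite -eps_antip antipVK. Qed.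

(** Applying the injective antihomomorphism [S] turns this into the axiom for
    [S] itself; the order of the factors is reversed, so that [S^-1] is the
    antipode for the opposite product. *)
Lemma antipV_rE h : sw2 (fun u v => v * S' u) h = (e h)%:A.
Proof.
apply: antip_inj; rewrite (sw2_lin (f := S)); last by lin.
rewrite linearZ /= antip1 -antip_rE; apply: sw2_eq => u v.
by rewrite antipM antipVK.
Qed.

End Inverse.
End Antipode.

(** * The product of the double *)

Section Double.
Variables (K : fieldType) (H : hopfAlg K).
Local Notation e := (eps H).
Implicit Types (h k u : H) (f g : Hdual H).

Lemma Hdual_separates u v : (forall f : Hdual H, f u = f v) -> u = v.
Proof.
move=> E; rewrite (coord_vbasis (memvf u)) (coord_vbasis (memvf v)).
by apply: eq_bigr => i _; have := E (Hdual_basis i); rewrite !lfunE /= => ->.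
Qed.

Lemma Hdual_mul_epsl f : Hdual_mul (e : Hdual H) f = f.
Proof. by apply/lfunP=> h; rewrite Hdual_mulE -[RHS]sw2_counitl //; lin. Qed.

Lemma Hdual_mul_epsr f : Hdual_mul f (e : Hdual H) = f.
Proof.
apply/lfunP=> h; rewrite Hdual_mulE -[RHS]sw2_counitr //; last by lin.
by apply: sw2_eq => u v; rewrite [LHS]mulrC.
Qed.

Lemma linear_Hdual_mull (U : vectType K) f (p : U -> Hdual H) :
  linear p -> linear (fun x => Hdual_mul f (p x)).
Proof.
move=> lp c x y; apply/lfunP=> h.
rewrite add_lfunE scale_lfunE !Hdual_mulE -tlift_comb; apply: tlift_eq => v w.
by rewrite lp add_lfunE scale_lfunE; rewrite mulrDr scalerAr.
Qed.

Lemma linear_Hdual_mulr (U : vectType K) f (p : U -> Hdual H) :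
  linear p -> linear (fun x => Hdual_mul (p x) f).
Proof.
move=> lp c x y; apply/lfunP=> h.
rewrite add_lfunE scale_lfunE !Hdual_mulE -tlift_comb; apply: tlift_eq => v w.
by rewrite lp add_lfunE scale_lfunE; rewrite mulrDl scalerAl.
Qed.

Lemma linear_hitl_fun (U : vectType K) b (p : U -> Hdual H) :
  linear p -> linear (fun x => hitl b (p x)).
Proof.
move=> lp c x y; apply/lfunP=> h.
by rewrite add_lfunE scale_lfunE !hitlE lp add_lfunE scale_lfunE.
Qed.

Lemma linear_hitr_fun (U : vectType K) b (p : U -> Hdual H) :
  linear p -> linear (fun x => hitr (p x) b).
Proof.
move=> lp c x y; apply/lfunP=> h.
by rewrite add_lfunE scale_lfunE !hitrE lp add_lfunE scale_lfunE.
Qed.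

Lemma linear_hitl_arg (U : vectType K) f (p : U -> H) :
  linear p -> linear (fun x => hitl (p x) f).
Proof.
move=> lp c x y; apply/lfunP=> h.
by rewrite add_lfunE scale_lfunE !hitlE lp mulrDr -scalerAr linearP.
Qed.

Lemma linear_hitr_arg (U : vectType K) f (p : U -> H) :
  linear p -> linear (fun x => hitr f (p x)).
Proof.
move=> lp c x y; apply/lfunP=> h.
by rewrite add_lfunE scale_lfunE !hitrE lp mulrDl -scalerAl linearP.
Qed.

End Double.

(** [dlin] extends [lin] to the expressions occurring in the product of the
    double. *)
Ltac dlin :=
  repeat first
    [ progress lin
    | apply: linear_Hdual_mull | apply: linear_Hdual_mulr
    | apply: linear_hitl_fun | apply: linear_hitr_fun
    | apply: linear_hitl_arg | apply: linear_hitr_arg ].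

Section DoubleProduct.
Variables (K : fieldType) (H : hopfAlg K).
Local Notation S := (antip H).
Local Notation S' := (antipV H).
Local Notation e := (eps H).
Implicit Types (h k u : H) (f g : Hdual H).

Lemma Ddouble_mul_tens g h f k :
  Ddouble_mul (tens g h) (tens f k) =
  sw3 (fun h1 h2 h3 =>
    tens (Hdual_mul g (hitr (hitl h1 f) (S' h3))) (h2 * k)) h.
Proof.
have bfk g' h' : bilin (fun f k => sw3 (fun h1 h2 h3 =>
    tens (Hdual_mul g' (hitr (hitl h1 f) (S' h3))) (h2 * k)) h').
  by rewrite /sw3; dlin.
rewrite /Ddouble_mul tlift_tens ?tlift_tens //.
split=> ?; apply: linear_tlift_param => ? ?; rewrite /sw3; dlin.
Qed.

Hypothesis antip_onto : forall h, exists k, S k = h.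

Lemma of_H_mul h k : Ddouble_mul (of_H h) (of_H k) = of_H (h * k).
Proof.
rewrite /of_H Ddouble_mul_tens.
transitivity (sw2 (fun p h3 => (e h3 : K) *:
   sw2 (fun h1 h2 => (e h1 : K) *: tens (e : Hdual H) (h2 * k)) p) h).
  apply: sw2_eq => p h3.
  rewrite (sw2_lin (f := fun z => (e h3 : K) *: z)); last by lin.
  apply: sw2_eq => h1 h2; rewrite scalerA.
  rewrite -(linear_at_scale (f := fun z : Hdual H => tens z (h2 * k)));
    last by lin.
  congr tens; rewrite Hdual_mul_epsl; apply/lfunP=> c.
  by rewrite hitrE hitlE scale_lfunE !epsM eps_antipV // mulrAC.
rewrite sw2_counitr; last by lin.
by rewrite (sw2_counitl (f := fun z => tens (e : Hdual H) (z * k))) //; lin.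
Qed.

Lemma sw3_1 (V : vectType K) (F : H -> H -> H -> V) : trilin F ->
  sw3 F 1 = F 1 1 1.
Proof.
case=> F1 F2 F3; rewrite /sw3 (sw2_tens _ (Delta1 H)); last by lin.
by rewrite (sw2_tens _ (Delta1 H)) //; split.
Qed.

Lemma of_Hdual_mul_of_H f h : Ddouble_mul (of_Hdual f) (of_H h) = tens f h.
Proof.
rewrite /of_Hdual /of_H Ddouble_mul_tens sw3_1; last by dlin.
rewrite mul1r; congr tens; rewrite -[RHS]Hdual_mul_epsr; congr Hdual_mul.
by apply/lfunP=> c; rewrite hitrE hitlE !epsM eps_antipV // eps1 mul1r mulr1.
Qed.

End DoubleProduct.

(** * Twisted central elements *)

Section TwistedCentral.
Variables (K : fieldType) (H : hopfAlg K).
Local Notation S := (antip H).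
Local Notation S' := (antipV H).
Local Notation e := (eps H).
Hypothesis antip_onto : forall h, exists k, S k = h.
Variables (beta : Hdual H) (u : H).

(** This is the Yetter-Drinfel'd compatibility for the one-dimensional module on
    which [H] acts by [beta] and coacts by [m |-> m (x) u]. *)
Definition twisted_central := forall h,
  sw2 (fun h1 h2 => (beta h1 : K) *: (h2 * u)) h =
  sw2 (fun h1 h2 => (beta h2 : K) *: (u * h1)) h.

(** Inserting the hypothesis in [sum h_(2) (beta(h_(1)) u)] produces
    [sum beta(h_(2)) h_(4) S^-1(h_(3)) u h_(1)], where the two factors
    [h_(4) S^-1(h_(3))] cancel. *)
Lemma straightening_central :
  (forall h, sw3 (fun h1 h2 h3 => (beta h2 : K) *: (S' h3 * u * h1)) h =
     (beta h : K) *: u) -> twisted_central.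
Proof.
move=> str h; pose R p := sw2 (fun h1 h2 => (beta h2 : K) *: (u * h1)) p.
have lR : linear R by apply: linear_sw2; lin.
transitivity (sw2 (fun q h4 => sw2 (fun p h3 => h4 * (S' h3 * R p)) q) h).
  apply: sw2_eq => q h4.
  rewrite -(sw2_lin (f := fun z => h4 * z)); last by lin.
  rewrite scalerAr -str; congr (_ * _); apply: sw2_eq => p h3.
  rewrite (sw2_lin (f := fun z => S' h3 * z)); last by lin.
  by apply: sw2_eq => h1 h2; rewrite -scalerAr mulrA.
rewrite (sw2_coassoc (F := fun p h3 h4 => h4 * (S' h3 * R p))); last first.
  by split=> ? ?; [do 2!apply: linear_mull | lin | lin].
rewrite -/(R h) -[RHS](sw2_counitr h lR); apply: sw2_eq => p r.
transitivity (sw2 (fun a b => b * S' a) r * R p).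
  rewrite (sw2_lin (f := fun z => z * R p)); last by lin.
  by apply: sw2_eq => a b; rewrite mulrA.
by rewrite antipV_rE // mulr_algl.
Qed.

(** In [sum beta(h_(2)) h_(3) u S^-1(h_(1))] twisted centrality moves [u] to the
    left, which leaves [u h_(2) S^-1(h_(1))] with a cancelling pair. *)
Lemma bullet_central : twisted_central ->
  forall h, bullet beta h u = (beta h : K) *: u.
Proof.
move=> central h.
rewrite /bullet /sw3 sw2_coassoc; last by lin.
transitivity (sw2 (fun h1 q =>
    sw2 (fun q1 q2 => (beta q2 : K) *: (u * (q1 * S' h1))) q) h).
  apply: sw2_eq => h1 q; transitivity
      (sw2 (fun q1 q2 => (beta q1 : K) *: (q2 * u)) q * S' h1).
    rewrite (sw2_lin (f := fun z => z * S' h1)); last by lin.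
    by apply: sw2_eq => q1 q2; rewrite scalerAl.
  rewrite central (sw2_lin (f := fun z => z * S' h1)); last by lin.
  by apply: sw2_eq => q1 q2; rewrite -scalerAl mulrA.
rewrite -(sw2_coassoc (F := fun h1 q1 q2 =>
    (beta q2 : K) *: (u * (q1 * S' h1)))); last by lin.
have l : linear (fun h => (beta h : K) *: u) by lin.
rewrite -(sw2_counitl h l); apply: sw2_eq => p h3.
rewrite -(sw2_lin (f := fun z => (beta h3 : K) *: (u * z))); last by lin.
by rewrite antipV_rE // mulr_algr scalerA mulrC -scalerA.
Qed.

End TwistedCentral.

(** * One-dimensional modules over the double *)

Section OneDimensional.
Variables (K : fieldType) (H : hopfAlg K).
Local Notation e := (eps H).

Lemma memv_tensv (V W : vectType K) (A : {vspace V}) (B : {vspace W}) v w :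
  v \in A -> w \in B -> tens v w \in tensv A B.
Proof.
move=> Av Bw; have [br bl] := tens_bilin V W.
rewrite (coord_vbasis Av) (lin_sum (f := (@tens _ V W)^~ w)) //.
apply: memv_suml => i _; apply: memvZ; rewrite (coord_vbasis Bw) lin_sum //.
apply: memv_suml => j _; apply: memvZ; apply: memv_span.
by apply/allpairsP; exists ((vbasis A)`_i, (vbasis B)`_j);
   rewrite ?mem_nth ?size_tuple.
Qed.

Lemma tmap_tens (V V' W W' : vectType K) (f : 'Hom(V, V')) (g : 'Hom(W, W'))
    v w :
  tmap f g (tens v w) = tens (f v) (g w).
Proof. by rewrite /tmap tlift_tens //; lin. Qed.

Lemma tassoc_tens (U V W : vectType K) u (v : V) w :
  tassoc (tens (tens u v) w) = tens (u : U) (tens v (w : W)).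
Proof.
rewrite /tassoc tlift_tens; first by rewrite tlift_tens //; lin.
split=> ?; last exact: linear_tlift.
by apply: linear_tlift_param => ? ?; lin.
Qed.

Lemma scalar_YD_module (M : ydData H) (beta : Hdual H) (u : H) :
  (forall h m, m \in yd_car M -> yd_act M h m = (beta h : K) *: m) ->
  (forall m, m \in yd_car M -> yd_coact M m = tens m u) ->
  beta 1 = 1 -> (forall h k, beta (h * k) = beta h * beta k) ->
  Delta H u = tens u u -> e u = 1 -> twisted_central beta u ->
  is_YD_module M.
Proof.
move=> act coact beta1 betaM Du eu central; split.
- by move=> h m Mm; rewrite act // memvZ.
- by move=> m Mm; rewrite act // beta1 scale1r.
- by move=> h k m Mm; rewrite !act ?memvZ // betaM scalerA.
- by move=> m Mm; rewrite coact // memv_tensv ?memvf.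
- move=> m Mm; rewrite coact // !tmap_tens coact // !id_lfunE Du.
  exact: tassoc_tens.
- move=> m Mm; rewrite coact // tlift_tens; last by lin.
  by rewrite eu scale1r.
move=> h m Mm; transitivity (tens m (sw2 (fun h1 h2 =>
    (beta h1 : K) *: (h2 * u)) h)).
  rewrite (sw2_lin (f := tens m)); last by lin.
  apply: sw2_eq => h1 h2; rewrite coact // tmap_tens act // lfunE /=.
  rewrite (linear_at_scale (f := (@tens _ _ H)^~ (h2 * u))); last by lin.
  by rewrite (linear_at_scale (f := tens m)); last by lin.
rewrite central (sw2_lin (f := tens m)); last by lin.
apply: sw2_eq => h1 h2; rewrite act // coact ?memvZ //.
rewrite tmap_tens id_lfunE lfunE /=.
rewrite (linear_at_scale (f := (@tens _ _ H)^~ (u * h1))); last by lin.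
by rewrite (linear_at_scale (f := tens m)); last by lin.
Qed.

Lemma scalar_Ddouble_module (M : DdoubleData H)
    (alpha : 'Hom(Ddouble H, K^o)) :
  (forall s m, m \in dm_car M -> dm_act M s m = (alpha s : K) *: m) ->
  Ddouble_algebra_map alpha -> is_Ddouble_module M.
Proof.
move=> act [alpha1 alphaM]; split.
- by move=> s m Mm; rewrite act // memvZ.
- by move=> m Mm; rewrite act // alpha1 scale1r.
- by move=> s t m Mm; rewrite !act ?memvZ // alphaM scalerA.
Qed.

Variable alpha : 'Hom(Ddouble H, K^o).
Hypothesis alphaP : Ddouble_algebra_map alpha.
Hypothesis antip_onto : forall h, exists k, antip H k = h.

Definition alpha_H : Hdual H := linfun (fun h => alpha (of_H h)).

(** Since [H] is finite-dimensional, the restriction of [alpha] to [H^*] is the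
    evaluation at an element of [H]: this one, see [alpha_ptE]. *)
Definition alpha_pt : H :=
  \sum_i (alpha (of_Hdual (Hdual_basis i)) : K) *: (vbasis {:H})`_i.

Lemma alpha_HE h : alpha_H h = alpha (of_H h).
Proof. by rewrite linfunE_lin //; apply: linear_hom; apply: linear_tensr. Qed.

Lemma alpha_ptE f : alpha (of_Hdual f) = f alpha_pt.
Proof.
have fE : f = \sum_(i < \dim {:H}) (f (vbasis {:H})`_i : K) *: Hdual_basis i.
  apply/lfunP=> h; rewrite {1}(coord_vbasis (memvf h)) linear_sum sum_lfunE.
  apply: eq_bigr => i _; rewrite linearZ scale_lfunE lfunE /=.
  by rewrite [LHS]mulrC.
rewrite {1}fE (lin_sum (f := @of_Hdual K H)); last exact: (tens_bilin _ _).2.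
rewrite /alpha_pt !linear_sum; apply: eq_bigr => i _.
by rewrite !linearZ /= [LHS]mulrC.
Qed.

Lemma alpha_H1 : alpha_H 1 = 1.
Proof. by rewrite alpha_HE; exact: alphaP.1. Qed.

Lemma alpha_HM h k : alpha_H (h * k) = alpha_H h * alpha_H k.
Proof. by rewrite !alpha_HE -alphaP.2 of_H_mul. Qed.

Lemma alpha_tens f h : alpha (tens f h) = f alpha_pt * alpha_H h.
Proof. by rewrite -of_Hdual_mul_of_H // alphaP.2 alpha_ptE alpha_HE. Qed.

(** Multiplicativity of [alpha] on the product [h f] of [h] in [H] and [f] in
    [H^*], rewritten by the straightening rule of the double, is the identity
    [beta(h) f(u) = sum beta(h_(2)) f(S^-1(h_(3)) u h_(1))]; as [f] is
    arbitrary it may be removed. *)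
Lemma alpha_twisted_central : twisted_central alpha_H alpha_pt.
Proof.
apply: straightening_central => // h; apply: Hdual_separates => f.
rewrite linearZ /= -alpha_ptE alpha_HE.
rewrite -[RHS]alphaP.2 /of_H /of_Hdual Ddouble_mul_tens.
rewrite /sw3 !(sw2_lin (f := alpha)); try by lin.
rewrite (sw2_lin (f := f)); last by lin.
apply: sw2_eq => p h3; rewrite (sw2_lin (f := alpha)); last by lin.
rewrite (sw2_lin (f := f)); last by lin.
apply: sw2_eq => h1 h2; rewrite alpha_tens Hdual_mul_epsl hitrE hitlE mulr1.
by rewrite linearZ /= mulrC.
Qed.

Lemma eps_alpha_pt : e alpha_pt = 1.
Proof. by rewrite -alpha_ptE; exact: alphaP.1. Qed.

Lemma alpha_pt_neq0 : alpha_pt != 0.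
Proof.
apply: contra_eq_neq eps_alpha_pt => ->; rewrite linear0 eq_sym.
exact: oner_neq0.
Qed.

Lemma bullet_space_line : bullet_space alpha_H alpha_pt = <[alpha_pt]>%VS.
Proof.
have E := bullet_central antip_onto alpha_twisted_central.
apply/vspaceP=> v; apply/bullet_spaceP/vlineP=> [[h ->] | [c ->]].
  by exists (alpha_H h).
exists c%:A; rewrite E linearZ /= alpha_H1; congr (_ *: _).
by rewrite [RHS]mulr1.
Qed.

(** Both modules are one-dimensional, and on both [H] acts through [alpha_H]
    while the coaction is [m |-> m (x) alpha_pt]; hence any linear bijection
    between them, here [k |-> k *: alpha_pt], is an isomorphism. *)
Theorem one_dimensional_bullet
    (Dpt : Delta H alpha_pt = tens alpha_pt alpha_pt) :
  YD_iso (YD_of_Ddouble (char_module alpha)) (bullet_module alpha_H alpha_pt)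
  /\ Ddouble_iso (char_module alpha)
       (Ddouble_of_YD (bullet_module alpha_H alpha_pt)).
Proof.
set u := alpha_pt; set N := bullet_module _ _; set M := char_module alpha.
have Nact h m : m \in yd_car N -> yd_act N h m = (alpha_H h : K) *: m.
  rewrite /= bullet_space_line => /vlineP[c ->].
  rewrite bullet_lfunE (linear_at_scale _ _ (bullet_linearr _ _)).
  rewrite bullet_central ?scalerA ?[c * _]mulrC //.
  exact: alpha_twisted_central.
have Ncoact m : m \in yd_car N -> yd_coact N m = tens m u.
  rewrite /= bullet_space_line => /vlineP[c ->]; rewrite linearZ /= Dpt.
  by rewrite (linear_at_scale (f := (@tens _ H H)^~ u)) //; lin.
have Mact h m : yd_act (YD_of_Ddouble M) h m = (alpha_H h : K) *: m.
  by rewrite YD_of_Ddouble_actE char_module_act alpha_HE.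
have Mcoact m : yd_coact (YD_of_Ddouble M) m = tens m u.
  rewrite YD_of_Ddouble_coactE /coact_of_Ddouble /u /alpha_pt.
  rewrite lin_sum; last by lin.
  apply: eq_bigr => i _; rewrite char_module_act.
  by rewrite (linear_at_scale (f := (@tens _ K^o H)^~ _)); last by lin.
have YN : is_YD_module N.
  apply: (scalar_YD_module Nact Ncoact alpha_H1 alpha_HM Dpt eps_alpha_pt).
  exact: alpha_twisted_central.
have YM : is_YD_module (YD_of_Ddouble M).
  apply: (scalar_YD_module _ _ alpha_H1 alpha_HM Dpt eps_alpha_pt) => //.
  exact: alpha_twisted_central.
have Dtens f h m : m \in dm_car (Ddouble_of_YD N) ->
    dm_act (Ddouble_of_YD N) (tens f h) m = (alpha (tens f h) : K) *: m.
  move=> Nm; rewrite Ddouble_of_YD_act Nact // Ncoact ?memvZ //.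
  by rewrite contract_tens scalerA alpha_tens.
have Dact s m : m \in dm_car (Ddouble_of_YD N) ->
    dm_act (Ddouble_of_YD N) s m = (alpha s : K) *: m.
  move=> Nm; rewrite [in RHS](tensor_sum s) [in LHS](tensor_sum s).
  rewrite !linear_sum sum_lfunE scaler_suml; apply: eq_bigr => i _.
  rewrite !linear_sum sum_lfunE scaler_suml; apply: eq_bigr => j _.
  by rewrite !linearZ scale_lfunE Dtens // scalerA.
pose f : 'Hom(K^o, H) := linfun (fun k : K^o => (k : K) *: u).
have fE k : f k = (k : K) *: u by rewrite linfunE_lin //; lin.
have fbij : bij_between {:K^o} (bullet_space alpha_H u) f.
  split=> [k k' _ _ | ].
    rewrite !fE => /eqP; rewrite -subr_eq0 -scalerBl scaler_eq0.
    by rewrite (negPf alpha_pt_neq0) orbF subr_eq0 => /eqP.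
  rewrite bullet_space_line; apply/vspaceP=> v.
  apply/memv_imgP/vlineP=> [[k _ ->] | [k ->]]; exists k; rewrite ?memvf //.
have Nf m : f m \in yd_car N.
  by rewrite fE /= bullet_space_line memvZ ?memv_line.
split; split=> //.
- exists f => //; split=> [h m _ | m _]; first by rewrite Mact linearZ /= Nact.
  by rewrite Mcoact tmap_tens id_lfunE Ncoact.
- by apply: (scalar_Ddouble_module (alpha := alpha)) => // s m _;
    rewrite char_module_act.
- exact: (scalar_Ddouble_module (alpha := alpha)).
exists f => // s m _; rewrite Dact // char_module_act.
by rewrite -linearZ.
Qed.

End OneDimensional.

(** * The Hopf algebra generated by a group and a skew-primitive element *)

Section HDTheory.
Variables (gT : finGroupType) (K : fieldType) (D : datum gT K) (H : HD_alg D).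
Local Notation G := (grp H).
Local Notation x := (xgen H).
Local Notation a := (pt D).

Lemma grp1 : G 1%g = 1.
Proof. by have [] := HD_relP H. Qed.

Lemma grpM g h : G (g * h)%g = G g * G h.
Proof. by have [_ ->] := HD_relP H. Qed.

Lemma xgen_nilp : x ^+ ell D = 0.
Proof. by have [] := HD_relP H. Qed.

Lemma xgen_grp g : x * G g = chi D g *: (G g * x).
Proof. by have [_ _ _ ->] := HD_relP H. Qed.

Lemma grpVK g h : G g^-1 * (G g * h) = h.
Proof. by rewrite mulrA -grpM mulVg grp1 mul1r. Qed.

Lemma grpKV g h : G g * (G g^-1 * h) = h.
Proof. by rewrite mulrA -grpM mulgV grp1 mul1r. Qed.

(** By the universal property [H] is generated by [G] and [x]; a subspace that
    contains [1] and absorbs the generators on the left is then everything. *)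
Lemma HD_ind (V : {vspace H}) : 1 \in V ->
  (forall g v, v \in V -> G g * v \in V) ->
  (forall v, v \in V -> x * v \in V) -> forall h, h \in V.
Proof.
move=> V1 VG Vx h.
pose A := (<<[seq G g | g <- enum gT]>> + <[x]>)%VS.
have AG g : G g \in agenv A.
  apply/(subvP (sub_agenv A))/(subvP (addvSl _ _)); apply: memv_span.
  by rewrite map_f ?mem_enum.
have Ax : x \in agenv A.
  by apply/(subvP (sub_agenv A))/(subvP (addvSr _ _)); rewrite memv_line.
have [G1 GM Gx Gchi] := HD_relP H.
pose B := subvs_of <<A>>%AS; pose inj : {linear B -> H} := vsval.
have injM : monoid_morphism (vsval : B -> H).
  split=> //; apply/eqP.
  by rewrite /= algid_eq1 (subvP (sub1_agenv A)) ?memv_line.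
pose iM := GRing.isMonoidMorphism.Build B H (vsval : B -> H) injM.
pose iota : {lrmorphism B -> H} := HB.pack (vsval : B -> H) iM inj.
have r : HD_rel D (fun g => Subvs (AG g) : B) (Subvs Ax).
  split=> [|g k||g]; apply: val_inj; rewrite -![\val _]/(iota _).
  - by rewrite rmorph1.
  - by rewrite rmorphM /= GM.
  - by rewrite rmorphXn rmorph0.
  - by rewrite linearZ !rmorphM /= Gchi.
pose p : {lrmorphism H -> H} :=
  GRing.LRMorphism.clone _ _ _ _ (iota \o HD_lift H r) _.
(* The universal property is used twice: it retracts [H] on the subalgebra
   generated by [G] and [x], and shows that this retraction is the identity. *)
have -> : h = p h.
  suff -> : p h = idfun h by [].
  apply: HD_lift_uniq => [g|]; first by rewrite /= HD_lift_grp.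
  by rewrite /= HD_lift_xgen.
suff /subvP : (agenv A <= V)%VS by apply; apply: subvsP.
apply: agenv_sub_modl; first by rewrite -memvE.
apply/prodvP=> _ v /memv_addP[u1 Vu1 [_ /vlineP[c ->] ->]] Vv.
rewrite mulrDl -scalerAl memvD ?memvZ ?Vx //.
have /subvP/(_ _ Vu1) : (<<[seq G g | g <- enum gT]>> <= amulr v @^-1: V)%VS.
  by apply/span_subvP=> _ /mapP[g _ ->]; rewrite -memv_preim lfunE VG.
by rewrite -memv_preim lfunE.
Qed.

Lemma grp_neq0 g : G g != 0.
Proof.
apply/eqP=> g0; have := grpKV g 1; rewrite g0 mul0r => /eqP.
by rewrite eq_sym oner_eq0.
Qed.

Lemma eps_grp g : eps H (G g) = 1.
Proof.
have := Delta_counitl (G g); rewrite Delta_grp tlift_tens; last by lin.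
move/eqP; rewrite -subr_eq0 -{3}[G g]scale1r -scalerBl scaler_eq0.
by rewrite (negPf (grp_neq0 g)) orbF subr_eq0 => /eqP.
Qed.

Lemma eps_xgen : eps H x = 0.
Proof.
have := Delta_counitl x; rewrite Delta_xgen linearD /= !tlift_tens; try by lin.
move/eqP; rewrite eps1 scale1r -subr_eq0 addrK scaler_eq0.
by rewrite (negPf (grp_neq0 _)) orbF => /eqP.
Qed.

Lemma antip_grp g : antip H (G g) = G g^-1.
Proof.
have := antip_lE (G g); rewrite (sw2_tens _ (Delta_grp H g)); last by lin.
rewrite eps_grp scale1r => E.
by rewrite -[LHS]mulr1 -grp1 -(mulgV g) grpM mulrA E mul1r.
Qed.

Lemma antip_xgen : antip H x = - (x * G a^-1).
Proof.
have := antip_lE x; rewrite /sw2 Delta_xgen linearD /= !tlift_tens; try by lin.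
rewrite eps_xgen scale0r antip1 mul1r => /eqP.
rewrite addr_eq0 => /eqP E.
by rewrite -mulNr -E -mulrA -grpM mulgV grp1 mulr1.
Qed.

(** The image of the antihomomorphism [antip H] contains the generators,
    because [S(g) = g^-1] and [S(a^-1 x) = - x]. *)
Lemma HD_antip_onto h : exists k, antip H k = h.
Proof.
suff /memv_imgP[k _ ->] : h \in limg (antip H) by exists k.
apply: HD_ind h => [|g _ /memv_imgP[k _ ->]|_ /memv_imgP[k _ ->]].
- by rewrite -antip1 memv_img ?memvf.
- have <- : antip H (k * G g^-1) = G g * antip H k.
    by rewrite antipM antip_grp invgK.
  by rewrite memv_img ?memvf.
have <- : antip H (k * - (G a^-1 * x)) = x * antip H k.
  rewrite antipM linearN /= antipM antip_grp antip_xgen invgK !mulNr opprK.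
  by rewrite -(mulrA x) -grpM mulVg grp1 mulr1.
by rewrite memv_img ?memvf.
Qed.

Lemma functional_eq_on_generators (f f' : Hdual H) :
  f 1 = 1 -> (forall h k, f (h * k) = f h * f k) ->
  f' 1 = 1 -> (forall h k, f' (h * k) = f' h * f' k) ->
  (forall g, f (G g) = f' (G g)) -> f x = f' x -> f = f'.
Proof.
move=> f1 fM f'1 f'M fG fx; apply/lfunP=> h; apply/eqP.
have kerE k : (k \in lker (f - f')) = (f k == f' k).
  by rewrite memv_ker add_lfunE opp_lfunE subr_eq0.
rewrite -kerE; apply: HD_ind h => [|g v|v]; rewrite !kerE.
- by rewrite f1 f'1.
- by move/eqP=> E; rewrite fM f'M fG E.
- by move/eqP=> E; rewrite fM f'M fx E.
Qed.

Definition group_span : {vspace H} := <<[seq G g | g <- enum gT]>>%VS.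

Lemma grp_group_span g : G g \in group_span.
Proof. by rewrite memv_span ?map_f ?mem_enum. Qed.

Lemma group_spanP u : u \in group_span ->
  exists c : gT -> K, u = \sum_g c g *: G g.
Proof.
move=> Xu; exists (fun g => coord (codom_tuple G) (enum_rank g) u).
rewrite {1}(coord_span (X := codom_tuple G) Xu).
rewrite (reindex enum_rank); last by apply: onW_bij; apply: enum_rank_bij.
by apply: eq_bigr => g _; rewrite nth_codom enum_rankK.
Qed.

Lemma xgenX_grp j g : x ^+ j * G g = chi D g ^+ j *: (G g * x ^+ j).
Proof.
elim: j => [|j IH]; first by rewrite !expr0 mul1r mulr1 scale1r.
rewrite exprS -mulrA IH -scalerAr (mulrA x) xgen_grp -scalerAl scalerA -exprSr.
by rewrite mulrA.
Qed.

Lemma char_funX (gamma : character gT K) g n :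
  gamma (g ^+ n)%g = gamma g ^+ n.
Proof.
elim: n => [|n IH]; first by rewrite expg0 char_fun1.
by rewrite expgS char_funM IH exprS.
Qed.

Lemma PBW_span h :
  h \in <<[seq (G g * x ^+ j)%R | g <- enum gT, j <- iota 0 (ell D)]>>%VS.
Proof.
set X := (X in <<X>>%VS); have mX g j : G g * x ^+ j \in <<X>>%VS.
  have [jl|lj] := ltnP j (ell D); last first.
    by rewrite -(subnKC lj) exprD xgen_nilp mul0r mulr0 mem0v.
  apply/memv_span/allpairsP; exists (g, j).
  by rewrite mem_enum mem_iota.
apply: HD_ind h => [|g v Xv|v Xv].
- by have := mX 1%g 0; rewrite grp1 mul1r.
- have /subvP/(_ _ Xv) : (<<X>> <= amull (G g) @^-1: <<X>>)%VS.
    apply/span_subvP=> _ /allpairsP[[k j] [_ _ ->]].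
    by rewrite -memv_preim lfunE /= mulrA -grpM.
  by rewrite -memv_preim lfunE.
have /subvP/(_ _ Xv) : (<<X>> <= amull x @^-1: <<X>>)%VS.
  apply/span_subvP=> _ /allpairsP[[k j] [_ _ ->]].
  by rewrite -memv_preim lfunE /= mulrA xgen_grp -scalerAl -mulrA -exprS memvZ.
by rewrite -memv_preim lfunE.
Qed.

(** Conjugation by [a] multiplies [g x^j] by a power of [chi(a)^j], and
    [chi(a)] has order [ell].  Averaging over the conjugates by
    [1, a, ..., a^(ell-1)] therefore kills the monomials with [0 < j < ell],
    while it fixes an element that commutes with [a]. *)
Lemma centraliser_group_span u : (ell D)%:R != 0 :> K -> abelian [set: gT] ->
  u * G a = G a * u -> u \in group_span.
Proof.
move=> ell0 abG ua.
pose E := \sum_(i < ell D) (amull (G (a ^+ i)^-1) \o amulr (G (a ^+ i)%g))%VF.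
have EE v : E v = \sum_(i < ell D) G (a ^+ i)^-1 * (v * G (a ^+ i)%g).
  by rewrite sum_lfunE; apply: eq_bigr => i _; rewrite comp_lfunE !lfunE.
have Eu : E u = (ell D)%:R *: u.
  rewrite EE scaler_nat -[in RHS](card_ord (ell D)) -sumr_const.
  apply: eq_bigr => i _; have -> : u * G (a ^+ i)%g = G (a ^+ i)%g * u.
    elim: (nat_of_ord i) => [|n IH]; first by rewrite expg0 grp1 mulr1 mul1r.
    by rewrite expgS grpM mulrA ua -mulrA IH mulrA.
  by rewrite grpVK.
suff : E u \in group_span.
  by rewrite Eu => /(memvZ (ell D)%:R^-1); rewrite scalerA mulVf // scale1r.
have /subvP/(_ _ (PBW_span u)) :
    (<<[seq (G g * x ^+ j)%R | g <- enum gT, j <- iota 0 (ell D)]>>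
       <= E @^-1: group_span)%VS; last by rewrite -memv_preim.
apply/span_subvP=> _ /allpairsP[[g j] [_ /= jl ->]]; rewrite -memv_preim EE.
pose z := chi D a ^+ j.
have -> : \sum_(i < ell D) G (a ^+ i)^-1 * (G g * x ^+ j * G (a ^+ i)%g) =
    (\sum_(i < ell D) z ^+ i) *: (G g * x ^+ j).
  rewrite scaler_suml; apply: eq_bigr => i _.
  rewrite -mulrA xgenX_grp char_funX -!scalerAr -!exprM mulnC; congr (_ *: _).
  rewrite !mulrA -!grpM; congr (G _ * _).
  by rewrite -mulgA (centsP abG g _ (a ^+ i)%g) ?inE // mulgA mulVg mul1g.
have [->|j0] := eqVneq j 0%N.
  by rewrite expr0 mulr1 memvZ ?grp_group_span.
suff -> : \sum_(i < ell D) z ^+ i = 0 by rewrite scale0r mem0v.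
(* A geometric sum over the powers of z, a root of unity other than 1. *)
apply/eqP; have /eqP := subrX1 z (ell D).
rewrite -exprM mulnC exprM (prim_expr_order (ell_order D)) expr1n subrr eq_sym.
rewrite mulf_eq0 subr_eq0 => /orP[|//].
rewrite -(prim_order_dvd (ell_order D)) => dvd_j.
have := dvdn_leq (_ : 0 < j)%N dvd_j; rewrite lt0n => /(_ j0).
by rewrite leqNgt; move: jl; rewrite mem_iota add0n => /andP[_ ->].
Qed.

End HDTheory.

Lemma group_span_characters (K : closedFieldType) (gT : finGroupType)
    (char0 : [pchar K] =i pred0) (abG : abelian [set: gT])
    (D : datum gT K) (H : HD_alg D) (u : H) (b : gT) : u \in group_span H ->
  (forall gamma : character gT K, char_ext H gamma u = gamma b) ->
  u = grp H b.
Proof.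
case/group_spanP=> c u_c E.
have c0 := characters_separate char0 abG (c := fun g => c g - (g == b)%:R).
have {}c0 g : c g = (g == b)%:R.
  apply/eqP; rewrite -subr_eq0; apply/eqP; apply: c0 => gamma.
  transitivity (\sum_g c g * gamma g - gamma b).
    under eq_bigr => k _ do rewrite mulrBl.
    rewrite -[in RHS](mul1r (gamma b)) big_split /= sumrN; congr (_ - _).
    rewrite (bigD1 b) //= eqxx big1 ?addr0 // => k kb.
    by rewrite (negPf kb) mul0r.
  rewrite -E u_c linear_sum /=; apply/eqP; rewrite subr_eq0; apply/eqP.
  by apply: eq_bigr => k _; rewrite linearZ /= char_ext_grp.
rewrite u_c (bigD1 b) //= c0 eqxx scale1r big1 ?addr0 // => g gb.
by rewrite c0 (negPf gb) scale0r.
Qed.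

Theorem proposition3p5 (K : closedFieldType) (gT : finGroupType)
    (char0 : [pchar K] =i pred0) (abG : abelian [set: gT])
    (D : datum gT K) (ell_ge2 : (2 <= ell D)%N) (H : HD_alg D)
    (alpha : 'Hom(Ddouble H, K^o)) (alphaP : Ddouble_algebra_map alpha)
    (beta : character gT K) (b : gT)
    (beta_b : forall (g : gT) (gamma : character gT K),
       alpha (Ddouble_mul (of_H (grp H g)) (of_Hdual (char_ext H gamma)))
       = beta g * gamma b) :
  YD_iso (YD_of_Ddouble (char_module alpha))
         (bullet_module (char_ext H beta) (grp H b))
  /\ Ddouble_iso (char_module alpha)
       (Ddouble_of_YD (bullet_module (char_ext H beta) (grp H b))).
Proof.
have onto := @HD_antip_onto _ _ _ H.
have a1 := alpha_H1 alphaP; have aM := alpha_HM alphaP onto.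
have alpha_char gamma : char_ext H gamma (alpha_pt alpha) = gamma b.
  rewrite -alpha_ptE -[RHS]mul1r -(char_fun1 beta) -beta_b alphaP.2 grp1.
  by rewrite -alpha_HE a1 mul1r.
have char_ext1 : char_ext H beta 1 = 1 by rewrite lfunE /= rmorph1.
have alpha_grp g : alpha_H alpha (grp H g) = beta g.
  pose triv := @Character gT K (fun=> 1) erefl (fun _ _ => esym (mulr1 1)).
  rewrite -[RHS]mulr1 -[1]/(triv b) -beta_b alphaP.2 alpha_HE alpha_ptE.
  by rewrite alpha_char mulr1.
(* [x] is nilpotent and [K] is a field. *)
have alpha_x : alpha_H alpha (xgen H) = 0.
  have aX n : alpha_H alpha (xgen H ^+ n) = alpha_H alpha (xgen H) ^+ n.
    by elim: n => [|n IH]; rewrite ?expr0 // !exprS aM IH.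
  have /eqP := aX (ell D); rewrite xgen_nilp linear0 eq_sym expf_eq0.
  by case/andP=> _ /eqP.
have betaE : alpha_H alpha = char_ext H beta.
  apply: functional_eq_on_generators => // [|g|]; first exact: char_extM.
    by rewrite alpha_grp char_ext_grp.
  by rewrite alpha_x char_ext_xgen.
have ptE : alpha_pt alpha = grp H b.
  apply: group_span_characters => //; apply: centraliser_group_span => //.
    by rewrite ((pcharf0P K).1 char0) -lt0n (prim_order_gt0 (ell_order D)).
  (* For a group-like element, twisted centrality is plain commutation. *)
  have := alpha_twisted_central alphaP onto (grp H (pt D)).
  rewrite !(sw2_tens _ (Delta_grp H _)); try by lin.
  have bN0 : (alpha_H alpha (grp H (pt D)) : K) != 0.
    apply/eqP=> z; have := aM (grp H (pt D)) (grp H (pt D)^-1).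
    by rewrite -grpM mulgV grp1 a1 z mul0r => /eqP; rewrite oner_eq0.
  by move/(scalerI bN0).
rewrite -betaE -ptE; apply: one_dimensional_bullet => //.
by rewrite ptE Delta_grp.
Qed.
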